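(* Let $k\ge 2$ be an integer. For any class $\mathcal{K}\subseteq\Omega$ of Boolean functions the following conditions are equivalent: (1) $\mathcal{K}\in\mathbf{I}(W^{k})$; (2) $w_{k}\in\mathcal{K}\subseteq W^{k}$, and $\mathcal{K}$ is an equational class satisfying $Z_{k}\mathcal{K}=\mathcal{K}$.
   Context: $\Omega$ is the set of all Boolean functions $f\colon\{0,1\}^n\to\{0,1\}$, $n\ge 1$. An $m$-ary $g$ is a subfunction of an $n$-ary $f$ if there is a map $\sigma\colon\{1,\dots,n\}\to\{1,\dots,m\}$ with $g(x_1,\dots,x_m)=f(x_{\sigma(1)},\dots,x_{\sigma(n)})$ identically. An equational class is a set $\mathcal{K}\subseteq\Omega$ (possibly empty) such that every subfunction of a member of $\mathcal{K}$ is in $\mathcal{K}$. For an $n$-ary $f$ and $m$-ary $g_1,\dots,g_n$, the composition $f(g_1,\dots,g_n)$ is the $m$-ary function $\mathbf{a}\mapsto f(g_1(\mathbf{a}),\dots,g_n(\mathbf{a}))$; $\mathcal{K}$ is composition-closed if all compositions $f(g_1,\dots,g_n)$ with $f,g_1,\dots,g_n\in\mathcal{K}$ ($g_i$ of equal arity) belong to $\mathcal{K}$. A clone is a composition-closed subset of $\Omega$ containing all projections; $[\mathcal{K}]$ is the smallest clone containing $\mathcal{K}$. $\mathbf{I}$ is the set of all composition-closed equational classes, and $\mathbf{I}(\mathcal{C})=\{\mathcal{K}\in\mathbf{I}:[\mathcal{K}]=\mathcal{C}\}$. An $n$-ary $f$ preserves a relation $P\subseteq\{0,1\}^k$ if applying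 $f$ coordinatewise to any $n$ members of $P$ gives a member of $P$. For an integer $k\ge2$, $W^k$ is the clone of functions preserving $\{0,1\}^k\setminus\{\mathbf{0}\}$, where $\mathbf{0}=(0,\dots,0)$. $w_k$ is the $(k+2)$-ary function with $w_k(x_1,\dots,x_{k+2})=0$ if $|\{i:x_i=1\}|=2$ and $x_1=1$, and $w_k(x_1,\dots,x_{k+2})=1$ otherwise (it generates the clone $W^k$). For $n$-ary $f$, $f^{-1}(0)=\{\mathbf{a}\in\{0,1\}^n:f(\mathbf{a})=0\}$. $Z_k\mathcal{K}$ is the set of all $f\in\Omega$ such that for every subset $H\subseteq f^{-1}(0)$ with at most $k$ elements there is $g\in\mathcal{K}$ of the same arity as $f$ with $H\subseteq g^{-1}(0)$. *)

(* Defs.v *)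
From mathcomp Require Import all_boot.
From mathcomp Require Import classical_sets.

Set Implicit Arguments.
Unset Strict Implicit.
Unset Printing Implicit Defensive.

Local Open Scope classical_set_scope.

Definition bvec (n : nat) := {ffun 'I_n -> bool}.

Definition boolfun (n : nat) := {ffun bvec n -> bool}.

(* Members of Omega have arity n >= 1: the tag n stands for arity n.+1. *)
Definition Omega : Type := {n : nat & boolfun n.+1}.

Definition omega (n : nat) (f : boolfun n.+1) : Omega :=
  Tagged (fun n => boolfun n.+1) f.

Definition arity (f : Omega) : nat := (tag f).+1.

Definition fun_of (f : Omega) : boolfun (arity f) := tagged f.

Definition subfunction (m n : nat) (g : boolfun m) (f : boolfun n) : Prop :=
  exists sigma : 'I_n -> 'I_m,
    forall x : bvec m, g x = f [ffun i => x (sigma i)].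

Definition equational_class (K : set Omega) : Prop :=
  forall (n m : nat) (f : boolfun n.+1) (g : boolfun m.+1),
    K (omega f) -> subfunction g f -> K (omega g).

Definition compose (n m : nat) (f : boolfun n) (g : 'I_n -> boolfun m) :
    boolfun m :=
  [ffun a => f [ffun i => g i a]].

Definition composition_closed (K : set Omega) : Prop :=
  forall (n m : nat) (f : boolfun n.+1) (g : 'I_n.+1 -> boolfun m.+1),
    K (omega f) -> (forall i, K (omega (g i))) -> K (omega (compose f g)).

Definition projection (n : nat) (i : 'I_n) : boolfun n := [ffun x : bvec n => x i].

Definition is_clone (C : set Omega) : Prop :=
  composition_closed C /\
  forall (n : nat) (i : 'I_n.+1), C (omega (projection i)).

Definition generated_clone (K : set Omega) : set Omega := smallest is_clone K.

Definition closed_equational_classes : set (set Omega) :=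
  [set K | equational_class K /\ composition_closed K].

Definition closed_classes_generating (C : set Omega) : set (set Omega) :=
  [set K | closed_equational_classes K /\ generated_clone K = C].

Definition preserves (n k : nat) (f : boolfun n) (P : {set bvec k}) : Prop :=
  forall M : 'I_n -> bvec k,
    (forall i, M i \in P) -> [ffun j => f [ffun i => M i j]] \in P.

Definition zero_bvec (k : nat) : bvec k := [ffun=> false].

Definition W (k : nat) : set Omega :=
  [set f : Omega | preserves (fun_of f) [set~ zero_bvec k]%SET].

Definition w (k : nat) : boolfun k.+2 :=
  [ffun x : bvec k.+2 => ~~ ((#|[set i | x i]%SET| == 2) && x ord0)].

Definition zeros (n : nat) (f : boolfun n) : {set bvec n} :=
  [set a | f a == false]%SET.

Definition Z (k : nat) (K : set Omega) : set Omega :=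
  [set f : Omega | forall H : {set bvec (arity f)},
     H \subset zeros (fun_of f) -> #|H| <= k ->
     exists2 g : boolfun (tag f).+1, K (omega g) & H \subset zeros g].

(* Main.v *)
Require Import Defs.
From mathcomp Require Import all_boot.
From mathcomp Require Import classical_sets.
From mathcomp Require Import boolp.
From mathcomp Require Import fintype finset.

(** A function lies in W k exactly when any k of its zeros vanish together at
    some coordinate.  From this the operator Z k interacts with W k as follows.

    If K is contained in W k and Z k K = K, then K is composition-closed: at
    most k zeros of f(g_1, ..., g_n) are mapped by (g_1, ..., g_n) to at most k
    zeros of f, these share a zero coordinate i, and so g_i vanishes at all of
    the given points ([Z_fixed_composition_closed]).

    The converse rests on a Baker-Pixley argument, and the difficulty is that a
    composition-closed equational class need not contain the projections.  Two
    facts make up for this.  If K contains implication and its members take the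
    value 1 at the all-ones vector, as those of W k do, then K is upward closed:
    if g <= f and g is in K then f is in K ([upward_closed]).  And if w k is in
    K, functions of K that vanish on all but one point of a set of more than k
    zeros of f can be merged by w k into a function of K that vanishes on the
    whole set.  Hence an f in Z k K lies above some member of K, and is
    therefore in K ([Z_sub]).  Applied to the clone generated by K, this also
    shows that K generates W k, since every member of W k is in Z k of the
    projections ([W_sub_generated]).

    It remains to see that a class K generating W k contains w k.  As w k is
    not in W k.+1, some f in K has k.+1 zeros without a common zero coordinate.
    If f vanishes at the zero vector, K contains the projections, so it equals
    W k.  Otherwise implication is a subfunction of f, and substituting joins
    of implications into f produces a member of K whose zeros include those of
    w k; upward closure then gives w k ([w_mem_of_generates]). *)

Set Implicit Arguments.
Unset Strict Implicit.
Unset Printing Implicit Defensive.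

Local Open Scope classical_set_scope.

(** * Functions preserving the nonzero vectors *)

(** Coordinate i of the k points b 0, ..., b k.-1 is the i-th column of the
    matrix to which f is applied row by row; the columns are members of the
    relation when they are nonzero. *)
Lemma mem_WP k n (f : boolfun n.+1) :
  W k (omega f) <->
  forall b : 'I_k -> bvec n.+1,
    (forall j, f (b j) = false) -> exists i, forall j, b j i = false.
Proof.
split=> [Wf b fb0 | Wf M M_nz].
- have [|/existsPn none] := boolP [exists i, [forall j, ~~ b j i]].
    by case/existsP=> i /forallP bi; exists i => j; apply/negbTE.
  have nz i : [ffun j => b j i] \in [set~ zero_bvec k]%SET.
    have := none i; rewrite negb_forall !inE => /existsP[j].
    rewrite negbK => bji; apply/eqP=> /ffunP M0; have := M0 j.
    by rewrite !ffunE bji.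
  have := Wf _ nz; rewrite !inE => /eqP[]; apply/ffunP=> j.
  rewrite !ffunE -[RHS](fb0 j); congr (f _).
  by apply/ffunP=> i; rewrite !ffunE.
- rewrite !inE; apply/eqP=> f0.
  have [|i Mi0] := Wf (fun j => [ffun i => M i j]).
    by move=> j; move/ffunP/(_ j): f0; rewrite !ffunE.
  have := M_nz i; rewrite !inE => /eqP; apply.
  by apply/ffunP=> j; have := Mi0 j; rewrite !ffunE.
Qed.

(** The form of [mem_WP] for sets of zeros: an enumeration of H may be padded to
    length k by repeating a point. *)
Lemma W_common_zero k n (f : boolfun n.+1) (H : {set bvec n.+1}) :
  W k (omega f) -> H \subset zeros f -> #|H| <= k ->
  exists i, forall a, a \in H -> a i = false.
Proof.
move=> /mem_WP Wf /subsetP Hf leHk; have [->|[a0 Ha0]] := set_0Vmem H.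
  by exists ord0 => a; rewrite inE.
have [|i bi] := Wf (fun j => nth a0 (enum H) j).
  move=> j; apply/eqP; have: nth a0 (enum H) j \in H.
    have [lt_j|le_j] := ltnP j (size (enum H)); last by rewrite nth_default.
    by rewrite -mem_enum mem_nth.
  by move/Hf; rewrite inE.
exists i => a; rewrite -mem_enum => Ha.
have lt_a : index a (enum H) < k.
  by apply: leq_trans leHk; rewrite cardE index_mem.
by have := bi (Ordinal lt_a); rewrite /= nth_index.
Qed.

Lemma W_at_ones k n (f : boolfun n.+1) :
  0 < k -> W k (omega f) -> f [ffun=> true] = true.
Proof.
move=> k_gt0 /mem_WP Wf; case f1: (f _) => //.
by have [|i /(_ (Ordinal k_gt0))] := Wf (fun=> [ffun=> true]); rewrite ?ffunE.
Qed.

Lemma W_clone k : is_clone (W k).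
Proof.
split=> [n m f g /mem_WP Wf Wg | n i].
  apply/mem_WP => b b0.
  have [|i gi0] := Wf (fun j => [ffun i => g i (b j)]).
    by move=> j; rewrite -(b0 j) ffunE.
  have /mem_WP Wgi := Wg i; apply: Wgi => j.
  by have := gi0 j; rewrite ffunE.
by apply/mem_WP => b b0; exists i => j; have := b0 j; rewrite ffunE.
Qed.

Lemma generated_clone_is_clone K : is_clone (generated_clone K).
Proof.
split=> [n m f g Cf Cg | n i] C CK.
  by apply: CK.1.1 => [|i]; [apply: Cf | apply: Cg].
exact: CK.1.2.
Qed.

Lemma clone_equational C : is_clone C -> equational_class C.
Proof.
move=> [compC projC] n m f g Cf [s gE].
have -> : g = compose f (fun i => projection (s i)).
  apply/ffunP=> x; rewrite gE ffunE; congr (f _).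
  by apply/ffunP=> i; rewrite !ffunE.
by apply: compC.
Qed.

(** The hypotheses say that identifying all variables of f yields the unary
    identity. *)
Lemma projection_of_unary K n (f : boolfun n.+1) :
  equational_class K -> K (omega f) ->
  f [ffun=> true] = true -> f [ffun=> false] = false ->
  forall m (i : 'I_m.+1), K (omega (projection i)).
Proof.
move=> eqK Kf f1 f0 m i; apply: eqK Kf _; exists (fun=> i) => x.
rewrite ffunE; case: (x i); [rewrite -[LHS]f1 | rewrite -[LHS]f0];
  by congr (f _); apply/ffunP=> j; rewrite !ffunE.
Qed.

(** * Classes containing implication *)

Definition imp : boolfun 2 := [ffun x : bvec 2 => x ord0 ==> x ord_max].

Definition implicative_class (K : set Omega) : Prop :=
  [/\ equational_class K, composition_closed K & K (omega imp)].

Definition imp_fun n (g h : boolfun n) : boolfun n :=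
  [ffun x => g x ==> h x].

Lemma imp_fun_closed K n (g h : boolfun n.+1) :
  implicative_class K -> K (omega g) -> K (omega h) -> K (omega (imp_fun g h)).
Proof.
move=> [_ compK impK] Kg Kh.
have -> : imp_fun g h = compose imp (fun i => if i == ord0 then g else h).
  by apply/ffunP=> x; rewrite !ffunE.
by apply: compK => // i; case: ifP.
Qed.

Lemma imp_projections_mem K n (i j : 'I_n.+1) :
  implicative_class K -> K (omega (imp_fun (projection i) (projection j))).
Proof.
move=> [eqK _ impK]; apply: eqK impK _.
exists (fun l => if l == ord0 then i else j) => x.
by rewrite !ffunE.
Qed.

(** Joins come from implication alone, as g || h = (g ==> h) ==> h.  The extra
    disjunct g makes the join nonempty: the constant 0 need not be in K. *)
Lemma join_closed K (I : finType) (P : pred I) n (g : boolfun n.+1)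
    (F : I -> boolfun n.+1) :
  implicative_class K -> K (omega g) -> (forall i, P i -> K (omega (F i))) ->
  K (omega [ffun x => g x || [exists (i | P i), F i x]]).
Proof.
move=> impK Kg KF.
have -> : [ffun x => g x || [exists (i | P i), F i x]] =
    [ffun x => g x || has (fun i => F i x) (enum P)] :> boolfun n.+1.
  apply/ffunP=> x; rewrite !ffunE; congr (_ || _).
  apply/existsP/hasP=> [[i /andP[Pi Fi]]|[i]]; first by exists i; rewrite ?mem_enum.
  by rewrite mem_enum => Pi Fi; exists i; apply/andP.
have: {in enum P, forall i, K (omega (F i))} by move=> i; rewrite mem_enum => /KF.
elim: (enum P) => [|i s IHs] Ks.
  by congr (K (omega _)): Kg; apply/ffunP=> x; rewrite ffunE orbF.
set G : boolfun n.+1 := [ffun x => g x || has (fun i => F i x) s].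
have KG : K (omega G) by apply: IHs => j sj; apply: Ks; rewrite inE sj orbT.
have KFi : K (omega (F i)) by apply: Ks; rewrite mem_head.
(* (F i ==> G) ==> G = F i || G *)
have := imp_fun_closed impK (imp_fun_closed impK KFi KG) KG.
congr (K (omega _)); apply/ffunP=> x; rewrite !ffunE /=.
by case: (F i x); case: (g x); case: (has _ _).
Qed.

(** The function with single zero a, where a has some zero coordinate because
    g vanishes at a.  If a also has a one coordinate, it is the join of the
    implications x_i ==> x_j with a_i = 1 and a_j = 0.  If a is the zero vector,
    g shows that K contains the projections, whose join is the function. *)
Lemma point_indicator K n (g : boolfun n.+1) (a : bvec n.+1) :
  implicative_class K ->
  (forall m (h : boolfun m.+1), K (omega h) -> h [ffun=> true] = true) ->
  K (omega g) -> g a = false ->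
  exists2 c : boolfun n.+1, K (omega c) & forall x, c x = (x != a).
Proof.
move=> impK oneK Kg ga; have [eqK _ _] := impK.
have [j aj] : exists j, a j = false.
  have [/existsP[j /negbTE aj]|/existsPn a1] := boolP [exists j, ~~ a j].
    by exists j.
  have aE : a = [ffun=> true].
    by apply/ffunP=> j; rewrite ffunE; apply/negPn/a1.
  by rewrite aE oneK in ga.
have [/existsP[i ai]|/existsPn a0] := boolP [exists i, a i].
  have := @join_closed K ('I_n.+1 * 'I_n.+1)%type
    (fun p => a p.1 && ~~ a p.2) n
    (imp_fun (projection i) (projection j))
    (fun p => imp_fun (projection p.1) (projection p.2)) impK.
  set c := [ffun x => _] => Kc; exists c.
    by apply: Kc => [|p _]; apply: imp_projections_mem.
  move=> x; rewrite !ffunE; have [->|x_a] := eqVneq x a.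
    rewrite ai aj /=; apply/existsP=> -[p /andP[/andP[a1 a2]]].
    by rewrite !ffunE a1 (negbTE a2).
  apply/orP.
  have [l xl] : exists l, x l != a l.
    apply/existsP; rewrite -negb_forall; apply: contra x_a => /forallP xa.
    by apply/eqP/ffunP=> l; apply/eqP.
  right; apply/existsP; case al: (a l) xl => xl.
    by exists (l, j); rewrite !ffunE /= al aj; case: (x l) xl.
  by exists (i, l); rewrite !ffunE /= al ai; case: (x l) xl => //= _; rewrite implybT.
have aE : a = [ffun=> false].
  by apply/ffunP=> i; rewrite ffunE; apply/negbTE/a0.
rewrite aE in ga.
have Kproj := projection_of_unary eqK Kg (oneK _ _ Kg) ga.
have := @join_closed K 'I_n.+1 predT n (projection j)
  (fun i => projection i) impK (Kproj _ _) (fun i _ => Kproj _ _).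
set c := [ffun x => _] => Kc; exists c => // x.
rewrite !ffunE aE; have [->|] := eqVneq x _.
  by rewrite ffunE /=; apply/existsP=> -[i]; rewrite !ffunE.
move=> x_0; apply/orP; right; apply/existsP.
case: (pickP (fun i => x i)) => [i xi|x0]; first by exists i; rewrite ffunE.
by case/eqP: x_0; apply/ffunP=> i; rewrite ffunE x0.
Qed.

(** The zeros of g that are not zeros of f can be removed one at a time:
    if c has single zero a, then c ==> g agrees with g except that it is 1
    at a. *)
Lemma upward_closed K n (f g : boolfun n.+1) :
  implicative_class K ->
  (forall m (h : boolfun m.+1), K (omega h) -> h [ffun=> true] = true) ->
  K (omega g) -> (forall x, g x ==> f x) -> K (omega f).
Proof.
move=> impK oneK.
have [m] := ubnP #|[set x | f x && ~~ g x]%SET|.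
elim: m g => // m IHm g le_m Kg gf.
have [D0|[a]] := set_0Vmem [set x | f x && ~~ g x]%SET.
  suff <- : g = f by [].
  apply/ffunP=> x; have := gf x; have: x \notin [set x | f x && ~~ g x]%SET.
    by rewrite D0 inE.
  by rewrite inE; case: (f x); case: (g x).
rewrite inE => /andP[fa ga].
have {}ga := negbTE ga.
have [c Kc cE] := point_indicator impK oneK Kg ga.
apply: (IHm (imp_fun c g)).
- apply: leq_trans (_ : #|[set x | f x && ~~ g x]%SET| <= m) => //.
  apply: proper_card; apply/properP; split.
    apply/subsetP=> x; rewrite !inE !ffunE => /andP[-> ].
    by rewrite negb_imply => /andP[].
  by exists a; rewrite !inE ?ffunE ?fa ?ga // cE eqxx.
- exact: imp_fun_closed.
- by move=> x; rewrite ffunE cE; have := gf x; have [->|] := eqVneq x a;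
    rewrite ?fa.
Qed.

(** * The functions w k *)

(** Separating the first argument: when it is 1, w k detects that exactly one of
    the k.+1 remaining arguments is 1. *)
Lemma w_exactly_one k (x : bvec k.+2) :
  w k x = ~~ (x ord0 && (#|[set j : 'I_k.+1 | x (lift ord0 j)]%SET| == 1)).
Proof.
rewrite ffunE andbC; case x0: (x ord0) => //=; congr (~~ _).
have cardE m (y : 'I_m -> bool) : #|[set i | y i]%SET| = \sum_i y i.
  rewrite -sum1_card big_mkcond; apply: eq_bigr => i _.
  by rewrite inE; case: (y i).
by rewrite !cardE big_ord_recl x0.
Qed.

(** Each zero of w k singles out one of k.+1 coordinates, so k zeros miss
    one, and they all vanish there. *)
Lemma w_in_W k : W k (omega (w k)).
Proof.
apply/mem_WP => b b0.
have [s sE] : exists s : 'I_k -> 'I_k.+1,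
    forall j i, b j (lift ord0 i) = (i == s j).
  apply: (@fin_all_exists _ (fun _ => 'I_k.+1)
    (fun j l => forall i, b j (lift ord0 i) = (i == l))) => j.
  have := b0 j; rewrite w_exactly_one => /negbFE/andP[_ /cards1P[l bl]].
  by exists l => i; have /setP/(_ i) := bl; rewrite !inE.
have [i Ni] : exists i, i \notin codom s.
  apply/existsP; rewrite -negb_forall; apply/forallP=> all_s.
  have: #|'I_k.+1| <= #|codom s|.
    by apply/subset_leq_card/subsetP=> i _; apply: all_s.
  by move/leq_trans/(_ (leq_image_card s predT)); rewrite !card_ord ltnn.
exists (lift ord0 i) => j; rewrite sE; apply/negbTE.
by apply: contra Ni => /eqP->; apply: codom_f.
Qed.

Lemma w_zero_at k (j : 'I_k.+1) :
  w k [ffun i => (i == ord0) || (i == lift ord0 j)] = false.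
Proof.
rewrite w_exactly_one !ffunE eqxx /=; apply/negbF/eqP.
rewrite -(cards1 j); congr #|pred_of_set _|; apply/setP=> i.
by rewrite !inE ffunE (inj_eq lift_inj).
Qed.

(** The k.+1 zeros of w k cover all coordinates. *)
Lemma w_notin_W_succ k : ~ W k.+1 (omega (w k)).
Proof.
move=> /mem_WP /(_ _ (@w_zero_at k)) [i].
case: (unliftP ord0 i) => [j ->|->] b0.
  by have := b0 j; rewrite ffunE eqxx orbT.
by have := b0 ord0; rewrite ffunE eqxx.
Qed.

(** The weight of the argument is 2p + kq, which is 2 for p = 1 only if q = 0. *)
Lemma w_two_blocks k (p q : bool) :
  0 < k -> w k [ffun i : 'I_k.+2 => if i < 2 then p else q] = (p ==> q).
Proof.
move=> k_gt0; rewrite w_exactly_one !ffunE /=; case: p => //=.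
have -> : [set j : 'I_k.+1 | [ffun i : 'I_k.+2 => if i < 2 then true else q] (lift ord0 j)]%SET
   = [set j : 'I_k.+1 | (j == ord0) || q]%SET.
  by apply/setP=> j; rewrite !inE ffunE /= /bump /= -val_eqE /=; case: (nat_of_ord j); case: q.
case: q.
  rewrite (_ : [set j | _]%SET = setT) ?cardsT ?card_ord; last first.
    by apply/setP=> j; rewrite !inE orbT.
  by case: k k_gt0.
rewrite (_ : [set j | _]%SET = [set ord0]%SET) ?cards1 //.
by apply/setP=> j; rewrite !inE orbF.
Qed.

Lemma w_to_implicative K k :
  0 < k -> equational_class K -> composition_closed K -> K (omega (w k)) ->
  implicative_class K.
Proof.
move=> k_gt0 eqK compK Kw; split=> //.
apply: eqK Kw _; exists (fun i : 'I_k.+2 => if i < 2 then ord0 else ord_max) => x.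
rewrite ffunE -(w_two_blocks _ _ k_gt0); congr (w k _).
by apply/ffunP=> i; rewrite !ffunE; case: ifP.
Qed.

(** * Classes fixed by Z k *)

(** It suffices to find g in K vanishing on H for every set H of zeros of f,
    by [upward_closed].  For #|H| > k, choose distinct h_0, ..., h_k in H and
    by induction g_j in K vanishing on H minus h_j.  At each point of H at most
    one of g_0, ..., g_k is 1, but w k (1, g_0, ..., g_k) vanishes only where
    exactly one is.  Replacing g_k by (g_0 || ... || g_(k-1)) ==> g_k, which is
    1 where all the g_j are 0, makes exactly one of
    them 1 all over H. *)
Lemma Z_sub K k :
  2 <= k -> equational_class K -> composition_closed K -> K (omega (w k)) ->
  K `<=` W k -> Z k K `<=` K.
Proof.
move=> k_ge2 eqK compK Kw KW [n f] Zf.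
have impK := w_to_implicative (ltnW k_ge2) eqK compK Kw.
have oneK m (h : boolfun m.+1) : K (omega h) -> h [ffun=> true] = true.
  by move/KW/W_at_ones; apply; apply: leq_trans k_ge2.
suff [g Kg] : exists2 g : boolfun n.+1, K (omega g) & zeros f \subset zeros g.
  move/subsetP=> fg; apply: (@upward_closed K n f g impK oneK Kg) => x.
  have := fg x; rewrite !inE; case: (f x); rewrite ?implybT // => /(_ isT).
  by move/eqP->.
have: zeros f \subset zeros f by [].
move: {-2}(zeros f) => H; have [m] := ubnP #|H|.
elim: m H => // m IHm H le_Hm Hf.
have [le_Hk|lt_kH] := leqP #|H| k; first exact: Zf.
pose h (j : 'I_k.+1) := enum_val (widen_ord lt_kH j).
have h_inj : injective h.
  by move=> i j /enum_val_inj /(congr1 val) /= /val_inj.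
have [g Kg gH] : exists2 g : 'I_k.+1 -> boolfun n.+1,
    forall j, K (omega (g j)) & forall j, H :\ h j \subset zeros (g j).
  apply: (@fin_all_exists2 _ (fun _ => boolfun n.+1) (fun _ g => K (omega g))
    (fun j g => is_true (H :\ h j \subset zeros g))) => j.
  apply: IHm; last by apply: subset_trans Hf; rewrite subD1set.
  by rewrite -ltnS (leq_ltn_trans _ le_Hm) // [leqRHS](cardsD1 (h j)) enum_valP.
have g0 x j : x \in H -> x != h j -> g j x = false.
  by move=> Hx xj; have /subsetP/(_ x) := gH j; rewrite !inE xj Hx => /(_ isT)/eqP.
have ord0_max : (ord0 : 'I_k.+1) != ord_max by case: (k) k_ge2.
(* The join of the g j with j != ord_max; since ord0 != ord_max, the separate
   g ord0 adds nothing, and serves as the first member required by a join. *)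
pose u : boolfun n.+1 := [ffun x => g ord0 x || [exists (j | j != ord_max), g j x]].
have Ku : K (omega u) by apply: join_closed.
have uE x : u x = [exists (j | j != ord_max), g j x].
  rewrite ffunE; apply/orP/idP=> [[g0x|//]|]; last by right.
  by apply/existsP; exists ord0; rewrite ord0_max.
pose v j := if j == ord_max then imp_fun u (g ord_max) else g j.
pose one : boolfun n.+1 := imp_fun (projection ord0) (projection ord0).
exists (compose (w k) (fun i => if unlift ord0 i is Some j then v j else one)).
  apply: compK => // i; case: (unlift _ _) => [j|]; last exact: imp_projections_mem.
  by rewrite /v; case: ifP => // _; apply: imp_fun_closed.
apply/subsetP=> x Hx; rewrite inE ffunE w_exactly_one !ffunE unlift_none !ffunE implybb /=.
rewrite eqbF_neg negbK; apply/cards1P.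
have E j : [ffun i => (if unlift ord0 i is Some j then v j else one) x]
    (lift ord0 j) = v j x.
  by rewrite ffunE liftK.
have [/existsP[i /andP[i_max gi]]|no_g] := boolP [exists (j | j != ord_max), g j x].
  have xi : x = h i by apply/eqP; apply: contraTT gi => xi; rewrite g0.
  exists i; apply/setP=> j; rewrite !inE E /v; have [->|j_max] := eqVneq j ord_max.
    rewrite ffunE uE g0 // ?xi ?(inj_eq h_inj) // eq_sym (negbTE i_max) -xi.
    by apply/negbTE; rewrite negb_imply andbT; apply/existsP; exists i; rewrite i_max.
  have [->//|ji] := eqVneq j i.
  by apply: g0; rewrite // xi (inj_eq h_inj) eq_sym.
exists ord_max; apply/setP=> j; rewrite !inE E /v; have [_|j_max] := eqVneq j ord_max.
  by rewrite ffunE uE (negbTE no_g).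
by move/existsPn: no_g => /(_ j); rewrite j_max /= => /negbTE.
Qed.

Lemma Z_extensive K k : K `<=` Z k K.
Proof. by case=> n f Kf H Hf _; exists f. Qed.

(** A projection vanishes on any given set of at most k zeros of a member of W k, so
    W k is contained in Z k of any clone. *)
Lemma W_sub_generated K k :
  2 <= k -> K (omega (w k)) -> K `<=` W k -> W k `<=` generated_clone K.
Proof.
move=> k_ge2 Kw KW; have cloneC := generated_clone_is_clone K.
have KC : K `<=` generated_clone K by move=> f Kf C [_ KC]; apply: KC.
have CW : generated_clone K `<=` W k by move=> f Cf; apply: Cf; split; [exact: W_clone|].
move=> [n f] Wf; apply: (Z_sub (k := k)) => //.
- exact: clone_equational.
- exact: cloneC.1.
- exact: KC.
move=> H Hf leHk; have [i Hi] := W_common_zero Wf Hf leHk.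
exists (projection i); first exact: cloneC.2.
by apply/subsetP=> a /Hi ai; rewrite inE ffunE ai.
Qed.

(** The points of H are sent by the inner functions to at most k zeros of f; at
    a common zero coordinate i of these, the inner function g i witnesses the
    membership in Z k K. *)
Lemma Z_fixed_composition_closed K k :
  K `<=` W k -> Z k K `<=` K -> composition_closed K.
Proof.
move=> KW ZK n m f g Kf Kg; apply: ZK => H /subsetP Hfg leHk.
pose G (a : bvec m.+1) : bvec n.+1 := [ffun i => g i a].
have [||i Hi] := @W_common_zero k n f [set G a | a in H]%SET (KW _ Kf).
- apply/subsetP=> _ /imsetP[a /Hfg Ha ->]; move: Ha.
  by rewrite !inE ffunE.
- exact: leq_trans (leq_imset_card _ _) leHk.
exists (g i); first exact: Kg.
apply/subsetP=> a Ha; rewrite inE; have := Hi _ (imset_f G Ha).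
by rewrite ffunE => ->.
Qed.

(** * Classes generating W k *)

(** Identify the variables of f according to b: the binary function obtained
    is 0 at (1, 0), and 1 at (0, 0) and (1, 1).  It is 1 at (0, 1) because a
    zero there would share no zero coordinate with (1, 0). *)
Lemma zero_to_implicative K k n (f : boolfun n.+1) b :
  2 <= k -> equational_class K -> composition_closed K -> K `<=` W k ->
  K (omega f) -> f b = false -> f [ffun=> false] = true -> implicative_class K.
Proof.
move=> k_ge2 eqK compK KW Kf fb f0; split=> //.
have f1 : f [ffun=> true] = true.
  by apply: W_at_ones (KW _ Kf); apply: leq_trans k_ge2.
apply: (eqK _ _ _ _ Kf); exists (fun i => if b i then ord0 else ord_max) => x.
rewrite ffunE; case x0: (x ord0); case x1: (x ord_max) => /=.
- rewrite -[LHS]f1; congr (f _); apply/ffunP=> i; rewrite !ffunE.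
  by case: ifP.
- rewrite -[LHS]fb; congr (f _); apply/ffunP=> i; rewrite !ffunE.
  by case: (b i).
- case fc: (f _) => //; have := @W_common_zero k n f
    [set b; [ffun i => x (if b i then ord0 else ord_max)]]%SET (KW _ Kf).
  case=> [||i Hi].
  + by apply/subsetP=> y; rewrite !inE => /orP[] /eqP->; rewrite ?fb ?fc.
  + by rewrite cards2; apply: leq_trans k_ge2; case: (_ != _).
  have bi := Hi _ (set21 _ _).
  by have := Hi _ (set22 _ _); rewrite ffunE bi x1.
- rewrite -[LHS]f0; congr (f _); apply/ffunP=> i; rewrite !ffunE.
  by case: ifP.
Qed.

(** Let b_0, ..., b_k be zeros of f in K without a common zero coordinate.  The
    j-th zero of w k has ones at x_0 and x_(j+1) only, so x_0 ==> x_(l+1) is 1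
    there exactly when l = j.  Hence t_i, the join of those implications with
    b_l(i) = 1, takes the value b_j(i) there, and f(t_0, ..., t_n) vanishes at
    all the zeros of w k.  The join is nonempty as the b_l do not all vanish
    at i. *)
Lemma w_mem_of_generates K k :
  2 <= k -> equational_class K -> composition_closed K ->
  generated_clone K = W k -> K (omega (w k)).
Proof.
move=> k_ge2 eqK compK genK; apply: contrapT => NKw.
have KW : K `<=` W k by rewrite -genK => f Kf C [_]; apply.
have oneK m (h : boolfun m.+1) : K (omega h) -> h [ffun=> true] = true.
  by move/KW/W_at_ones; apply; apply: leq_trans k_ge2.
suff KW1 : K `<=` W k.+1.
  have: W k (omega (w k)) by exact: w_in_W.
  by rewrite -genK => /(_ _ (conj (W_clone _) KW1)); apply: w_notin_W_succ.
move=> [n f] Kf; apply/mem_WP => b fb.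
have [/existsP[i /forallP bi]|/existsPn none] :=
    boolP [exists i, [forall j, ~~ b j i]].
  by exists i => j; apply/negbTE.
case: NKw; case f0: (f [ffun=> false]); last first.
  have Kproj := projection_of_unary eqK Kf (oneK _ _ Kf) f0.
  by have := @w_in_W k; rewrite -genK; apply; split.
have impK := zero_to_implicative k_ge2 eqK compK KW Kf (fb ord0) f0.
pose e (j : 'I_k.+1) : boolfun k.+2 :=
  imp_fun (projection ord0) (projection (lift ord0 j)).
have {}none i : exists j, b j i.
  by have := none i; rewrite negb_forall => /existsP[j]; rewrite negbK; exists j.
have [t Kt tE] : exists2 t : 'I_n.+1 -> boolfun k.+2,
    forall i, K (omega (t i)) &
    forall i x, t i x = [exists (j | b j i), e j x].
  apply: (@fin_all_exists2 _ (fun _ => boolfun k.+2) (fun _ t => K (omega t))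
    (fun i t => forall x, t x = [exists (j | b j i), e j x])) => i.
  have [j0 bj0] := none i.
  exists [ffun x => e j0 x || [exists (j | b j i), e j x]].
    by apply: join_closed => // [|j _]; apply: imp_projections_mem.
  move=> x; rewrite ffunE; apply/orP/idP=> [[ex|//]|]; last by right.
  by apply/existsP; exists j0; rewrite bj0.
apply: (@upward_closed _ _ _ (compose f t) impK oneK); first exact: compK.
move=> x; apply/implyP; apply: contraTT; rewrite w_exactly_one negbK => /andP[x0 /cards1P[j xj]].
rewrite ffunE (_ : [ffun i => _] = b j) ?fb //.
apply/ffunP=> i; rewrite ffunE tE.
have eE l : e l x = (l == j).
  by have /setP/(_ l) := xj; rewrite !inE !ffunE x0.
apply/existsP/idP=> [[l]|bji]; first by rewrite eE => /andP[bl /eqP <-].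
by exists j; rewrite eE bji eqxx.
Qed.

Theorem theorem6p4 (k : nat) (hk : 2 <= k) (K : set Omega) :
  closed_classes_generating (W k) K <->
  [/\ K (omega (w k)), K `<=` W k, equational_class K & Z k K = K].
Proof.
split=> [[[eqK compK] genK] | [Kw KW eqK ZK]].
- have Kw := w_mem_of_generates hk eqK compK genK.
  have KW : K `<=` W k by rewrite -genK => f Kf C [_]; apply.
  split=> //; apply/seteqP; split; last exact: Z_extensive.
  exact: Z_sub.
- split; first by split=> //; apply: (Z_fixed_composition_closed (k := k)); rewrite ?ZK.
  apply/seteqP; split; last exact: W_sub_generated.
  by move=> f; apply; split; [exact: W_clone|].
Qed.
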